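(* Let $\tilde\nu\in(0,1)$. Then $$J_{\tilde\nu}(x)\,J_{-\tilde\nu}(x)<\frac{\sin(\tilde\nu\pi)}{\tilde\nu\pi},\qquad\forall x>0.$$
   Context: $J_\mu$ denotes the Bessel function of the first kind of real order $\mu$: $J_\mu(x)=\sum_{k\ge0}\frac{(-1)^k}{k!\,\Gamma(k+\mu+1)}\left(\frac x2\right)^{2k+\mu}$ for $x>0$, with the convention $1/\Gamma(y)=0$ if $y$ is a non-positive integer. *)

(* Defs.v *)
From Stdlib Require Import Reals ZArith ClassicalEpsilon.
From Coquelicot Require Import Coquelicot.
Open Scope R_scope.

(* Euler's integral of the second kind; it converges exactly for y > 0. *)
Definition Euler_integral (y : R) : R :=
  RInt_gen (fun t => Rpower t (y - 1) * exp (- t))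
           (at_right 0) (Rbar_locally p_infty).

(* y (y + 1) ... (y + n - 1) *)
Fixpoint rising (y : R) (n : nat) : R :=
  match n with
  | O => 1
  | S m => rising y m * (y + INR m)
  end.

(* The least n : nat with y + n > 0, because [up r] is the least integer
   strictly above r.  In particular it is 0 when y > 0. *)
Definition Gamma_shift (y : R) : nat := Z.to_nat (up (- y)).

(* Euler's integral for y > 0, continued to the negative non-integers by
   Gamma (y + 1) = y * Gamma y.  The value at a pole is not meaningful. *)
Definition Gamma (y : R) : R :=
  Euler_integral (y + INR (Gamma_shift y)) / rising y (Gamma_shift y).

Definition inv_Gamma (y : R) : R :=
  if excluded_middle_informative (exists n : nat, y = - INR n)
  then 0 else / Gamma y.

(* Meaningful for x > 0, where [Rpower] is the real power. *)
Definition BesselJ (mu x : R) : R :=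
  Series (fun k : nat =>
    (-1) ^ k / INR (fact k) * inv_Gamma (INR k + mu + 1)
    * Rpower (x / 2) (2 * INR k + mu)).

(* Main.v *)
Require Import Defs.
From Stdlib Require Import Reals ZArith Factorial Lra Lia.
From Coquelicot Require Import Coquelicot.
Open Scope R_scope.

(** Write [s = (x / 2) ^ 2].  Pulling the power of [x] and the Gamma factor out
    of the two Bessel series leaves

      J_nu(x) J_{-nu}(x) = F(s) G(s) / (Gamma(1 + nu) Gamma(1 - nu)),

    where [F] and [G] are entire with [F 0 = G 0 = 1].  The theorem
    follows from [F s * G s < 1] for [s > 0] and from the half
    [1 / (Gamma(1 + nu) Gamma(1 - nu)) <= sin (nu PI) / (nu PI)]
    of the reflection formula.

    For the first part ([product_lt_1]), [F] and [G] solve the second-order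
    equations [s F'' + (nu + 1) F' + F = 0] and [s G'' + (1 - nu) G' + G = 0].
    Two conservation laws follow: the Wronskian identity

      s (F' G - F G') + nu F G = nu,

    and the fact that [M(s) = s^2 F' G' + s (F G - 1)] has derivative [F G - 1].
    Now [F G] starts at 1 and decreases at first.  If it ever came back to 1,
    look at the first such point [m].  Since [F G < 1] before [m], [M(m) < 0],
    that is, [F' G' < 0] at [m].  But at [m] the Wronskian identity reduces to
    [F' G = F G'], hence [F' G' = F' G' F G = (F' G)^2 >= 0], a contradiction.

    For the second part ([Euler_integral_reflection]), let
    [I_n(nu)] be the integral of [cos^(2n) t * cos (2 nu t)] over
    [[0, PI/2]].  Integration by parts gives
    [2 (n + 1 - nu) (n + 1 + nu) I_{n+1} = (n + 1) (2 n + 1) I_n],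
    and so in [K_n(nu) = Gamma(n + 1 + nu) Gamma(n + 1 - nu) I_n(nu)] the
    functional equation of Gamma cancels all dependence on [nu] of the
    recurrence: [K_n(nu) / K_n(0)] does not depend on [n].  For [n = 0] this
    ratio is [Gamma(1 + nu) Gamma(1 - nu) sin (nu PI) / (nu PI)].  For large [n]
    it is at least [n / (n + 1)], because Gamma is log-convex
    ([Euler_integral_log_convex]) and because the mass of [cos^(2n)]
    concentrates at [t = 0], where [cos (2 nu t)] is close to 1 ([cos_moment_ge]).
    Hence the ratio is at least 1. *)

(** * Products of two solutions of conjugate Bessel equations *)

(** The supremum of the [t] such that [f < 1] on all of [(0, t)]. *)
Lemma first_return_to_1 (f : R -> R) (d s : R) :
  (forall t, continuous f t) -> 0 < d ->
  (forall t, 0 < t < d -> f t < 1) -> 0 < s -> 1 <= f s ->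
  exists m, 0 < m /\ f m = 1 /\ forall t, 0 < t < m -> f t < 1.
Proof.
intros Cf Hd Hlt Hs Hfs.
set (E := fun t => forall u, 0 < u < t -> f u < 1).
destruct (completeness E) as [m [Hub Hlub]].
- exists s. intros t Ht. destruct (Rle_lt_dec t s) as [|Hst]; [easy|].
  specialize (Ht s). lra.
- exists d. intros u Hu. now apply Hlt.
- assert (Hdm : d <= m) by (apply Hub; intros u Hu; now apply Hlt).
  assert (HE : E m).
  { intros u Hu. destruct (Rlt_le_dec (f u) 1) as [|H1]; [easy|].
    enough (m <= u) by lra. apply Hlub. intros t Ht.
    destruct (Rle_lt_dec t u) as [|Hut]; [easy|].
    specialize (Ht u). lra. }
  exists m. split; [lra|]. split; [|exact HE].
  destruct (Rtotal_order (f m) 1) as [Hm|[Hm|Hm]]; [exfalso| exact Hm |exfalso].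
  + destruct (Cf m (fun y => y < 1)) as [e He].
    { apply (open_lt 1 (f m) Hm). }
    enough (m + e <= m) by (generalize (cond_pos e); lra).
    apply Hub. intros u Hu. destruct (Rlt_le_dec u m) as [Hum|Hmu].
    * apply HE; lra.
    * apply He. apply Rabs_def1; unfold minus, plus, opp; simpl; lra.
  + destruct (Cf m (fun y => 1 < y)) as [e He].
    { apply (open_gt 1 (f m) Hm). }
    pose proof (cond_pos e) as Hep.
    set (u := Rmax (m / 2) (m - e / 2)).
    assert (Hu : m / 2 <= u /\ m - e / 2 <= u /\ u < m).
    { repeat split; [apply Rmax_l|apply Rmax_r|]. apply Rmax_lub_lt; lra. }
    assert (1 < f u).
    { apply He. apply Rabs_def1; unfold minus, plus, opp; simpl; lra. }
    assert (f u < 1) by (apply HE; lra). lra.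
Qed.

(** Substituting [s = (x / 2) ^ 2] and dividing by [(x / 2)^mu] turns the
    Bessel equation of order [mu] into this one, which has
    a solution that is smooth at 0. *)
Record bessel_solution (mu : R) (F F1 F2 : R -> R) : Prop := {
  bessel_derive1 : forall s, is_derive F s (F1 s);
  bessel_derive2 : forall s, is_derive F1 s (F2 s);
  bessel_ode : forall s, s * F2 s + (mu + 1) * F1 s + F s = 0;
  bessel_at_0 : F 0 = 1 }.

(** The left side has derivative 0, by the two equations, and the value [nu]
    at 0. *)
Lemma wronskian nu F F1 F2 G G1 G2 s :
  bessel_solution nu F F1 F2 -> bessel_solution (- nu) G G1 G2 ->
  0 < s ->
  s * (F1 s * G s - F s * G1 s) + nu * (F s * G s) = nu.
Proof.
intros [dF dF1 odeF F0] [dG dG1 odeG G0] Hs.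
destruct (MVT_cor2 (fun s => s * (F1 s * G s - F s * G1 s) + nu * (F s * G s))
            (fun _ => 0) 0 s Hs) as [c [Hc _]].
- intros t _. apply is_derive_Reals. auto_derive.
  + repeat split; eexists; eauto.
  + rewrite (is_derive_unique (fun x : R => F x) _ _ (dF t)), (is_derive_unique (fun x : R => G x) _ _ (dG t)),
     (is_derive_unique (fun x : R => F1 x) _ _ (dF1 t)), (is_derive_unique (fun x : R => G1 x) _ _ (dG1 t)).
    replace (F t) with (- (t * F2 t) - (nu + 1) * F1 t) by (generalize (odeF t); lra).
    replace (G t) with (- (t * G2 t) - (- nu + 1) * G1 t) by (generalize (odeG t); lra).
    ring.
- rewrite F0, G0 in Hc. lra.
Qed.

(** The mean value theorem for [s^2 F' G' + s (F G - 1)], whose derivative is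
    [F G - 1]: the two equations give [(s^2 F' G')' = - s (F G)']. *)
Lemma energy_mean_value nu F F1 F2 G G1 G2 s :
  bessel_solution nu F F1 F2 -> bessel_solution (- nu) G G1 G2 ->
  0 < s ->
  exists c, 0 < c < s /\
  s ^ 2 * (F1 s * G1 s) + s * (F s * G s - 1) = s * (F c * G c - 1).
Proof.
intros [dF dF1 odeF F0] [dG dG1 odeG G0] Hs.
destruct (MVT_cor2 (fun s => s ^ 2 * (F1 s * G1 s) + s * (F s * G s - 1))
            (fun c => F c * G c - 1) 0 s Hs) as [c [Hc Hcs]].
- intros t _. apply is_derive_Reals. auto_derive.
  + repeat split; eexists; eauto.
  + rewrite (is_derive_unique (fun x : R => F x) _ _ (dF t)), (is_derive_unique (fun x : R => G x) _ _ (dG t)),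
     (is_derive_unique (fun x : R => F1 x) _ _ (dF1 t)), (is_derive_unique (fun x : R => G1 x) _ _ (dG1 t)).
    replace (F t) with (- (t * F2 t) - (nu + 1) * F1 t) by (generalize (odeF t); lra).
    replace (G t) with (- (t * G2 t) - (- nu + 1) * G1 t) by (generalize (odeG t); lra).
    ring.
- exists c. split; [lra|]. lra.
Qed.

(** At [s = 0] the equations reduce to [F' 0 = - 1 / (1 + nu)] and
    [G' 0 = - 1 / (1 - nu)], both negative. *)
Lemma product_initially_lt_1 nu F F1 F2 G G1 G2 :
  -1 < nu < 1 ->
  bessel_solution nu F F1 F2 -> bessel_solution (- nu) G G1 G2 ->
  exists d, 0 < d /\ forall t, 0 < t < d -> F t * G t < 1.
Proof.
intros Hnu [dF dF1 odeF F0] [dG dG1 odeG G0].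
set (l := F1 0 + G1 0).
assert (Hl : l < 0).
{ pose proof (odeF 0) as HF. pose proof (odeG 0) as HG.
  rewrite F0 in HF. rewrite G0 in HG. unfold l.
  assert (F1 0 < 0) by nra. assert (G1 0 < 0) by nra. lra. }
assert (D : derivable_pt_lim (fun s => F s * G s) 0 l).
{ apply is_derive_Reals. auto_derive.
  + repeat split; eexists; eauto.
  + rewrite (is_derive_unique (fun x : R => F x) _ _ (dF 0)), (is_derive_unique (fun x : R => G x) _ _ (dG 0)), F0, G0.
    unfold l; ring. }
destruct (D (- l) ltac:(lra)) as [d Hd].
exists d. split; [apply cond_pos|]. intros t Ht.
specialize (Hd t ltac:(lra)). rewrite Rplus_0_l, F0, G0 in Hd.
specialize (Hd ltac:(rewrite Rabs_pos_eq; lra)).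
apply Rabs_def2 in Hd.
assert (Q : (F t * G t - 1 * 1) / t < 0) by lra.
apply (Rmult_lt_compat_r t) in Q; [|lra].
replace ((F t * G t - 1 * 1) / t * t) with (F t * G t - 1) in Q by (field; lra).
lra.
Qed.

(** At a first return [m] to the value 1, the mean value of [F G - 1] on
    [[0, m]] is negative, and so is [F' G'] at [m]; but the Wronskian identity
    makes [F' G'] a square there. *)
Lemma product_lt_1 nu F F1 F2 G G1 G2 s :
  -1 < nu < 1 ->
  bessel_solution nu F F1 F2 -> bessel_solution (- nu) G G1 G2 ->
  0 < s -> F s * G s < 1.
Proof.
intros Hnu SF SG Hs. destruct (Rlt_le_dec (F s * G s) 1) as [|Hge]; [easy|exfalso].
destruct (product_initially_lt_1 _ _ _ _ _ _ _ Hnu SF SG) as [d [Hd Hlt]].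
destruct (first_return_to_1 (fun s => F s * G s) d s) as [m [Hm [Hm1 Hbelow]]]; auto.
- intros t. apply (ex_derive_continuous (fun s => F s * G s)).
  apply (ex_derive_mult F G); eexists; [apply SF|apply SG].
- pose proof (wronskian _ _ _ _ _ _ _ _ SF SG Hm) as HW. cbv beta in Hm1. rewrite Hm1 in HW.
  destruct (energy_mean_value _ _ _ _ _ _ _ _ SF SG Hm) as [c [Hc HE]]. rewrite Hm1 in HE.
  specialize (Hbelow c Hc). cbv beta in Hbelow.
  assert (E1 : F1 m * G m = F m * G1 m) by nra.
  assert (E2 : F1 m * G1 m = (F1 m * G m) ^ 2).
  { replace ((F1 m * G m) ^ 2) with ((F1 m * G m) * (F1 m * G m)) by ring.
    rewrite E1 at 2. replace (F1 m * G m * (F m * G1 m)) with (F1 m * G1 m * (F m * G m)) by ring.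
    rewrite Hm1; ring. }
  rewrite E2 in HE.
  pose proof (pow2_ge_0 (m * (F1 m * G m))). nra.
Qed.

(** * The normalised Bessel series *)

(** The coefficients of [Gamma(mu + 1) (x / 2)^(- mu) J_mu(x)] as a power
    series in [(x / 2) ^ 2]. *)
Definition bessel_coef (mu : R) (k : nat) : R :=
  (-1) ^ k / INR (fact k) / rising (mu + 1) k.

Lemma rising_pos y n : 0 < y -> 0 < rising y n.
Proof.
intros Hy. induction n as [|n IH]; simpl; [lra|].
apply Rmult_lt_0_compat; [easy|]. pose proof (pos_INR n). lra.
Qed.

Lemma bessel_coef_neq_0 mu k : -1 < mu -> bessel_coef mu k <> 0.
Proof.
intros Hmu. unfold bessel_coef, Rdiv.
repeat apply Rmult_integral_contrapositive_currified.
- apply pow_nonzero; lra.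
- apply Rinv_neq_0_compat, INR_fact_neq_0.
- apply Rinv_neq_0_compat, Rgt_not_eq, rising_pos; lra.
Qed.

Lemma bessel_coef_S mu k : -1 < mu ->
  INR (S k) * (INR k + mu + 1) * bessel_coef mu (S k) = - bessel_coef mu k.
Proof.
intros Hmu. unfold bessel_coef.
assert (rising (mu + 1) k <> 0) by (apply Rgt_not_eq, rising_pos; lra).
pose proof (pos_INR k). pose proof (INR_fact_neq_0 k).
rewrite fact_simpl, mult_INR. cbn [rising pow].
assert (INR (S k) <> 0) by now apply not_0_INR.
field. repeat split; try easy; lra.
Qed.

Lemma CV_radius_bessel mu : -1 < mu -> CV_radius (bessel_coef mu) = p_infty.
Proof.
intros Hmu. apply CV_radius_infinite_DAlembert.
- intros n; now apply bessel_coef_neq_0.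
- apply is_lim_seq_le_le with (u := fun _ => 0) (w := fun n => / (mu + 1) * / INR (S n)).
  + intros n. split; [apply Rabs_pos|].
    pose proof (bessel_coef_S mu n Hmu) as HS.
    pose proof (bessel_coef_neq_0 mu n Hmu) as H0.
    pose proof (pos_INR n).
    assert (HSn : 0 < INR (S n)) by (apply lt_0_INR; lia).
    assert (E : bessel_coef mu (S n) / bessel_coef mu n
            = - (/ (INR n + mu + 1) * / INR (S n))).
    { replace (bessel_coef mu n) with (- (INR (S n) * (INR n + mu + 1) * bessel_coef mu (S n))) by lra.
      pose proof (bessel_coef_neq_0 mu (S n) Hmu).
      field. repeat split; try easy; lra. }
    rewrite E, Rabs_Ropp, Rabs_pos_eq.
    * apply Rmult_le_compat_r; [apply Rlt_le, Rinv_0_lt_compat; lra|].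
      apply Rinv_le_contravar; lra.
    * apply Rmult_le_pos; apply Rlt_le, Rinv_0_lt_compat; lra.
  + apply is_lim_seq_const.
  + replace (Finite 0) with (Rbar_mult (/ (mu + 1)) 0) by (simpl; now rewrite Rmult_0_r).
    apply is_lim_seq_scal_l.
    apply (is_lim_seq_incr_1 (fun n => / INR n)).
    replace (Finite 0) with (Rbar_inv p_infty) by easy.
    apply is_lim_seq_inv; [apply is_lim_seq_INR|easy].
Qed.

Lemma PSeries_bessel_ode mu s : -1 < mu ->
  s * PSeries (PS_derive (PS_derive (bessel_coef mu))) s
  + (mu + 1) * PSeries (PS_derive (bessel_coef mu)) s
  + PSeries (bessel_coef mu) s = 0.
Proof.
intros Hmu. set (a := bessel_coef mu).
assert (CV : forall b, CV_radius b = p_infty -> ex_pseries b s).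
{ intros b Hb. apply CV_radius_inside. now rewrite Hb. }
assert (C0 : CV_radius a = p_infty) by now apply CV_radius_bessel.
assert (C1 : CV_radius (PS_derive a) = p_infty) by now rewrite CV_radius_derive.
assert (C2 : CV_radius (PS_derive (PS_derive a)) = p_infty) by now rewrite CV_radius_derive.
rewrite <- PSeries_incr_1, <- PSeries_scal.
assert (X2 : ex_pseries (PS_incr_1 (PS_derive (PS_derive a))) s).
{ apply CV. now rewrite CV_radius_incr_1. }
assert (X1 : ex_pseries (PS_scal (mu + 1) (PS_derive a)) s).
{ apply CV. now rewrite CV_radius_scal; [|lra]. }
rewrite <- PSeries_plus; try easy.
rewrite <- PSeries_plus; [|now apply (ex_pseries_plus _ _ s)|now apply CV].
rewrite (PSeries_ext _ (fun _ => 0)); [apply PSeries_const_0|].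
intros n. pose proof (bessel_coef_S mu n Hmu) as H. fold a in H.
destruct n as [|n].
- transitivity (0 + (mu + 1) * (INR 1 * a 1%nat) + a 0%nat); [easy|].
  simpl in *. lra.
- transitivity (INR (S n) * (INR (S (S n)) * a (S (S n)))
    + (mu + 1) * (INR (S (S n)) * a (S (S n))) + a (S n)); [easy|].
  lra.
Qed.

Lemma bessel_product_lt_1 nu s : 0 < nu < 1 -> 0 < s ->
  PSeries (bessel_coef nu) s * PSeries (bessel_coef (- nu)) s < 1.
Proof.
intros Hnu Hs.
assert (S : forall mu, -1 < mu -> bessel_solution mu (PSeries (bessel_coef mu))
  (PSeries (PS_derive (bessel_coef mu)))
  (PSeries (PS_derive (PS_derive (bessel_coef mu))))).
{ intros mu Hmu. split; intros.
  - apply is_derive_PSeries. now rewrite CV_radius_bessel.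
  - apply is_derive_PSeries. now rewrite CV_radius_derive, CV_radius_bessel.
  - now apply PSeries_bessel_ode.
  - rewrite PSeries_0. unfold bessel_coef; simpl. field. }
refine (product_lt_1 _ _ _ _ _ _ _ _ _ (S nu _) (S (- nu) _) Hs); lra.
Qed.


(** * Euler's integral of the second kind *)

(** The value of the improper integral is the supremum of the integrals over
    compact intervals, which increase with the interval. *)
Lemma is_RInt_gen_bounded_pos (f : R -> R) (A : R) :
  (forall t, 0 < t -> continuous f t) ->
  (forall t, 0 < t -> 0 < f t) ->
  (forall a b, 0 < a <= b -> RInt f a b <= A) ->
  exists l, 0 < l /\ is_RInt_gen f (at_right 0) (Rbar_locally p_infty) l.
Proof.
intros Cf Pf Bf.
assert (If : forall a b, 0 < a -> 0 < b -> ex_RInt f a b).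
{ intros a b Ha Hb. apply (ex_RInt_continuous f). intros z Hz. apply Cf.
  apply Rlt_le_trans with (2 := proj1 Hz). now apply Rmin_glb_lt. }
assert (Mf : forall a a0 b0 b, 0 < a <= a0 -> a0 <= b0 <= b -> RInt f a0 b0 <= RInt f a b).
{ intros a a0 b0 b Ha Hb.
  rewrite <- (RInt_Chasles f a a0 b), <- (RInt_Chasles f a0 b0 b) by (apply If; lra).
  unfold plus; simpl.
  assert (P : forall u v, 0 < u <= v -> 0 <= RInt f u v).
  { intros u v Huv. apply RInt_ge_0; [lra|apply If; lra|].
    intros x Hx. apply Rlt_le, Pf; lra. }
  pose proof (P a a0 ltac:(lra)). pose proof (P b0 b ltac:(lra)). lra. }
set (E := fun v => exists a b, 0 < a <= b /\ v = RInt f a b).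
destruct (completeness E) as [l [Hub Hlub]].
- exists A. intros v (a & b & Hab & ->). now apply Bf.
- exists (RInt f 1 1), 1, 1. split; [lra|easy].
- exists l. split.
  + apply Rlt_le_trans with (RInt f 1 2).
    * apply RInt_gt_0; [lra| |]; intros x Hx; [apply Pf|apply Cf]; lra.
    * apply Hub. exists 1, 2. split; [lra|easy].
  + intros P [e He].
    assert (HE : exists a b, 0 < a <= b /\ l - e < RInt f a b).
    { apply Classical_Prop.NNPP. intros N.
      enough (l <= l - e) by (generalize (cond_pos e); lra).
      apply Hlub. intros v (a & b & Hab & ->).
      destruct (Rle_lt_dec (RInt f a b) (l - e)) as [|H]; [easy|].
      exfalso; apply N; exists a, b; easy. }
    destruct HE as (a0 & b0 & Hab & Hl).
    apply Filter_prod with (Q := fun a => 0 < a < a0) (R := fun b => b0 < b).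
    * exists (mkposreal a0 (proj1 Hab)). intros a Ha Ha0. split; [easy|].
      apply Rabs_def2 in Ha. unfold minus, plus, opp in Ha; simpl in Ha. lra.
    * exists b0. easy.
    * intros a b Ha Hb. exists (RInt f a b). simpl. split.
      -- apply (RInt_correct f). apply If; lra.
      -- apply He.
         pose proof (Mf a a0 b0 b ltac:(lra) ltac:(lra)).
         assert (RInt f a b <= l) by (apply Hub; exists a, b; split; [lra|easy]).
         apply Rabs_def1; unfold minus, plus, opp; simpl; generalize (cond_pos e); lra.
Qed.

Lemma is_RInt_gen_nonneg (f : R -> R) (l : R) :
  (forall t, 0 < t -> 0 <= f t) ->
  is_RInt_gen f (at_right 0) (Rbar_locally p_infty) l -> 0 <= l.
Proof.
intros Pf Hf.
enough (H : norm l <= l) by (apply Rle_trans with (2 := H); apply norm_ge_0).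
assert (Q : filter_prod (at_right 0) (Rbar_locally p_infty)
   (fun ab => 0 < fst ab <= snd ab)).
{ apply Filter_prod with (Q := fun a => 0 < a < 1) (R := fun b => 1 < b).
  - exists (mkposreal 1 Rlt_0_1). intros a Ha Ha0. split; [easy|].
    apply Rabs_def2 in Ha. unfold minus, plus, opp in Ha; simpl in Ha. lra.
  - exists 1. easy.
  - simpl; intros; lra. }
apply (RInt_gen_norm (Fa := at_right 0) (Fb := Rbar_locally p_infty) f f); try easy.
- revert Q. apply filter_imp. intros; lra.
- revert Q. apply filter_imp. intros ab Hab x Hx.
  unfold norm; simpl; unfold abs; simpl. rewrite Rabs_pos_eq; [lra|]. apply Pf; lra.
Qed.

(** A variant of [is_RInt_gen_Derive] for an antiderivative that is only known
    on the open half-line, which is where powers of [t] are differentiable. *)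
Lemma is_RInt_gen_pos_Derive (f df : R -> R) (la lb : R) :
  (forall t, 0 < t -> is_derive f t (df t)) ->
  (forall t, 0 < t -> continuous df t) ->
  filterlim f (at_right 0) (locally la) ->
  filterlim f (Rbar_locally p_infty) (locally lb) ->
  is_RInt_gen df (at_right 0) (Rbar_locally p_infty) (lb - la).
Proof.
intros D C La Lb.
assert (Q : filter_prod (at_right 0) (Rbar_locally p_infty)
   (fun ab => forall x, Rmin (fst ab) (snd ab) <= x <= Rmax (fst ab) (snd ab) -> 0 < x)).
{ apply Filter_prod with (Q := fun a => 0 < a) (R := fun b => 0 < b).
  - exists (mkposreal 1 Rlt_0_1). easy.
  - exists 0. easy.
  - simpl; intros a b Ha Hb x Hx. apply Rlt_le_trans with (2 := proj1 Hx).
    now apply Rmin_glb_lt. }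
apply (is_RInt_gen_ext (Derive f)).
- revert Q. apply filter_imp. intros ab Hab x Hx. apply is_derive_unique, D, Hab. lra.
- apply is_RInt_gen_Derive; try easy.
  + revert Q. apply filter_imp. intros ab Hab x Hx. eexists. apply D, (Hab x Hx).
  + revert Q. apply filter_imp. intros ab Hab x Hx.
    apply (continuous_ext_loc _ df); [|now apply C, (Hab x Hx)].
    exists (mkposreal x (Hab x Hx)). intros y Hy. symmetry. apply is_derive_unique, D.
    apply Rabs_def2 in Hy. unfold minus, plus, opp in Hy; simpl in Hy. lra.
Qed.

Definition gamma_integrand (y t : R) : R := Rpower t (y - 1) * exp (- t).

Lemma is_derive_Rpower y t : 0 < t ->
  is_derive (fun t => Rpower t y) t (y * Rpower t (y - 1)).
Proof. intros Ht. apply is_derive_Reals. now apply derivable_pt_lim_power. Qed.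

Lemma continuous_gamma_integrand y t : 0 < t -> continuous (gamma_integrand y) t.
Proof.
intros Ht. apply (ex_derive_continuous (gamma_integrand y)).
unfold gamma_integrand. auto_derive.
eexists. now apply is_derive_Rpower.
Qed.

Lemma gamma_integrand_pos y t : 0 < gamma_integrand y t.
Proof. apply Rmult_lt_0_compat; apply exp_pos. Qed.

Lemma exp_le_compat x y : x <= y -> exp x <= exp y.
Proof. intros [H| ->]; [now apply Rlt_le, exp_increasing|lra]. Qed.

(** From [ln u <= u - 1] at [u = t / (2 y)], which bounds [t ^ y] by a multiple
    of [exp (t / 2)] on the whole half-line. *)
Lemma gamma_integrand_le y : 0 < y -> exists C, 0 < C /\
  forall t, 0 < t -> gamma_integrand (y + 1) t <= C * exp (- (t / 2)).
Proof.
intros Hy. exists (exp (y * ln (2 * y))). split; [apply exp_pos|].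
intros t Ht. unfold gamma_integrand, Rpower. rewrite <- !exp_plus.
apply exp_le_compat.
replace (y + 1 - 1) with y by ring.
assert (H : ln t <= t / (2 * y) - 1 + ln (2 * y)).
{ replace t with (t / (2 * y) * (2 * y)) at 1 by (field; lra).
  rewrite ln_mult by (try apply Rdiv_lt_0_compat; lra).
  assert (0 < t / (2 * y)) by (apply Rdiv_lt_0_compat; lra).
  pose proof (exp_ineq1_le (ln (t / (2 * y)))) as E. rewrite exp_ln in E by easy. lra. }
apply (Rmult_le_compat_l y) in H; [|lra].
replace (y * (t / (2 * y) - 1 + ln (2 * y))) with (t / 2 - y + y * ln (2 * y)) in H by (field; lra).
lra.
Qed.

Lemma is_derive_gamma_integrand y t : 0 < t ->
  is_derive (gamma_integrand (y + 1)) t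
    (y * gamma_integrand y t - gamma_integrand (y + 1) t).
Proof.
intros Ht. unfold gamma_integrand.
replace (y + 1 - 1) with y by ring.
pose proof (is_derive_Rpower y t Ht) as D.
auto_derive.
- eexists; eauto.
- rewrite (is_derive_unique (fun x : R => Rpower x y) _ _ D). ring.
Qed.

(** Integrating by parts once removes the singularity at 0 when [y < 1]:
    [y] times the integrand at [y] is the derivative of the integrand at [y + 1]
    plus that integrand itself, and the latter is at most [C exp (- t / 2)] by
    [gamma_integrand_le]. *)
Lemma Euler_integral_correct y : 0 < y ->
  0 < Euler_integral y /\
  is_RInt_gen (gamma_integrand y) (at_right 0) (Rbar_locally p_infty) (Euler_integral y).
Proof.
intros Hy. destruct (gamma_integrand_le y Hy) as (C & HC & Hle).
destruct (is_RInt_gen_bounded_pos (gamma_integrand y) (3 * C / y)) as (l & Hl & HI).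
- intros t; apply continuous_gamma_integrand.
- intros t _; apply gamma_integrand_pos.
- intros a b Hab.
  (* [h] dominates the integrand and has the bounded antiderivative [H]. *)
  set (H := fun t => / y * gamma_integrand (y + 1) t - 2 * C / y * exp (- (t / 2))).
  set (h := fun t => gamma_integrand y t - / y * gamma_integrand (y + 1) t
                     + C / y * exp (- (t / 2))).
  assert (DH : is_RInt h a b (minus (H b) (H a))).
  { apply (is_RInt_derive H).
    - intros x Hx. rewrite Rmin_left in Hx by lra.
      pose proof (is_derive_gamma_integrand y x ltac:(lra)) as D.
      unfold H, h. auto_derive.
      + eexists; eauto.
      + rewrite (is_derive_unique (fun x : R => gamma_integrand (y + 1) x) _ _ D). change (x * / 2) with (x / 2). field. lra.
    - intros x Hx. rewrite Rmin_left in Hx by lra.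
      apply (continuous_plus (fun t => gamma_integrand y t - / y * gamma_integrand (y + 1) t)).
      + apply (continuous_minus (gamma_integrand y)).
        * apply continuous_gamma_integrand; lra.
        * apply (continuous_scal_r (/ y) (gamma_integrand (y + 1))).
          apply continuous_gamma_integrand; lra.
      + apply (ex_derive_continuous (fun x => C / y * exp (- (x / 2)))). auto_derive. easy. }
  apply Rle_trans with (RInt h a b).
  + apply RInt_le; [lra| |eexists; eauto|].
    * apply (ex_RInt_continuous (gamma_integrand y)). intros z Hz.
      rewrite Rmin_left in Hz by lra. apply continuous_gamma_integrand; lra.
    * intros x Hx. unfold h. specialize (Hle x ltac:(lra)).
      apply (Rmult_le_compat_l (/ y)) in Hle; [|apply Rlt_le, Rinv_0_lt_compat; lra].
      unfold Rdiv at 1. lra.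
  + rewrite (is_RInt_unique _ _ _ _ DH). unfold H, minus, plus, opp; simpl.
    pose proof (Hle b ltac:(lra)) as Hb. pose proof (gamma_integrand_pos (y + 1) a) as Ga.
    assert (Yp : 0 < / y) by (apply Rinv_0_lt_compat; lra).
    pose proof (exp_pos (- (b / 2))) as Eb.
    assert (E1 : forall t, 0 < t -> exp (- (t / 2)) <= 1).
    { intros t Ht. rewrite <- exp_0. apply exp_le_compat. lra. }
    pose proof (E1 a ltac:(lra)) as Ea. pose proof (E1 b ltac:(lra)) as Eb1.
    replace (3 * C / y) with (/ y * (3 * C)) by (field; lra).
    match goal with |- ?l <= _ => replace l with
      (/ y * (gamma_integrand (y + 1) b - 2 * C * exp (- (b / 2))
              - gamma_integrand (y + 1) a + 2 * C * exp (- (a / 2)))) by (field; lra) end.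
    apply Rmult_le_compat_l; [lra|]. nra.
- assert (U : Euler_integral y = l).
  { apply (is_RInt_gen_unique (gamma_integrand y)), HI. }
  rewrite U. easy.
Qed.

Lemma is_lim_gamma_integrand_infty y : 0 < y ->
  filterlim (gamma_integrand (y + 1)) (Rbar_locally p_infty) (locally 0).
Proof.
intros Hy. destruct (gamma_integrand_le y Hy) as (C & HC & Hle).
intros P [e He]. exists (Rmax 0 (2 * ln (C / e))). intros t Ht. apply He.
assert (T0 : 0 < t) by (apply Rle_lt_trans with (2 := Ht); apply Rmax_l).
assert (T1 : 2 * ln (C / e) < t) by (apply Rle_lt_trans with (2 := Ht); apply Rmax_r).
pose proof (gamma_integrand_pos (y + 1) t) as Gp.
pose proof (cond_pos e) as Ep.
assert (gamma_integrand (y + 1) t < e).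
{ apply Rle_lt_trans with (1 := Hle t T0).
  assert (X : exp (- (t / 2)) < exp (- ln (C / e))) by (apply exp_increasing; lra).
  rewrite (exp_Ropp (ln (C / e))), exp_ln in X by (apply Rdiv_lt_0_compat; lra).
  apply (Rmult_lt_compat_l C) in X; [|easy].
  replace (C * / (C / e)) with (pos e) in X by (field; lra). easy. }
apply Rabs_def1; unfold minus, plus, opp; simpl; lra.
Qed.

Lemma is_lim_gamma_integrand_0 y : 0 < y ->
  filterlim (gamma_integrand (y + 1)) (at_right 0) (locally 0).
Proof.
intros Hy P [e He]. pose proof (cond_pos e) as Ep.
exists (mkposreal _ (exp_pos (ln e / y))). intros t Ht T0. apply He.
apply Rabs_def2 in Ht. unfold minus, plus, opp in Ht; simpl in Ht.
pose proof (gamma_integrand_pos (y + 1) t) as Gp.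
assert (gamma_integrand (y + 1) t < e).
{ unfold gamma_integrand, Rpower. replace (y + 1 - 1) with y by ring.
  rewrite <- exp_plus. rewrite <- (exp_ln e) by easy. apply exp_increasing.
  assert (L : ln t < ln e / y).
  { rewrite <- (ln_exp (ln e / y)). apply ln_increasing; lra. }
  apply (Rmult_lt_compat_l y) in L; [|easy].
  replace (y * (ln e / y)) with (ln e) in L by (field; lra). lra. }
apply Rabs_def1; unfold minus, plus, opp; simpl; lra.
Qed.

Lemma Euler_integral_S y : 0 < y -> Euler_integral (y + 1) = y * Euler_integral y.
Proof.
intros Hy.
destruct (Euler_integral_correct y Hy) as [_ I0].
destruct (Euler_integral_correct (y + 1) ltac:(lra)) as [_ I1].
pose proof (is_RInt_gen_minus _ _ _ _ (is_RInt_gen_scal _ y _ I0) I1) as I.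
assert (J : is_RInt_gen (fun t => y * gamma_integrand y t - gamma_integrand (y + 1) t)
  (at_right 0) (Rbar_locally p_infty) (0 - 0)).
{ apply (is_RInt_gen_pos_Derive (gamma_integrand (y + 1))).
  - intros t; apply is_derive_gamma_integrand.
  - intros t Ht. apply (continuous_minus (fun t => y * gamma_integrand y t)).
    + apply (continuous_scal_r y (gamma_integrand y)). now apply continuous_gamma_integrand.
    + now apply continuous_gamma_integrand.
  - now apply is_lim_gamma_integrand_0.
  - now apply is_lim_gamma_integrand_infty. }
pose proof (eq_trans (eq_sym (is_RInt_gen_unique (V := R_CompleteNormedModule) _ _ J))
  (is_RInt_gen_unique (V := R_CompleteNormedModule) _ _ I)) as E.
unfold minus, plus, opp, scal in E; simpl in E; unfold mult in E; simpl in E. lra.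
Qed.

Lemma Euler_integral_1 : Euler_integral 1 = 1.
Proof.
apply (is_RInt_gen_unique (V := R_CompleteNormedModule) (gamma_integrand 1)).
enough (I : is_RInt_gen (gamma_integrand 1) (at_right 0) (Rbar_locally p_infty) (0 - - 1)).
{ now replace (0 - - 1) with 1 in I by ring. }
apply (is_RInt_gen_pos_Derive (fun t => - exp (- t))).
- intros t Ht. auto_derive; [easy|]. unfold gamma_integrand. rewrite Rminus_diag, Rpower_O by easy. ring.
- intros t Ht. now apply (continuous_gamma_integrand 1).
- intros P HP.
  assert (C : continuous (fun t => - exp (- t)) 0).
  { apply (ex_derive_continuous (fun t => - exp (- t))). auto_derive. easy. }
  destruct (C P) as [d Hd].
  { now rewrite Ropp_0, exp_0. }
  exists d. intros t Ht _. now apply Hd.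
- intros P [e He]. exists (- ln e). intros t Ht. apply He.
  pose proof (cond_pos e) as Ep. pose proof (exp_pos (- t)).
  assert (exp (- t) < e).
  { rewrite <- (exp_ln e) by easy. apply exp_increasing. lra. }
  apply Rabs_def1; unfold minus, plus, opp; simpl; lra.
Qed.

(** Log-convexity at a midpoint, in the form of a discriminant: the quadratic
    [A ^ 2 u ^ 2 - 2 A A2 u + A2 ^ 2 = (A u - A2) ^ 2] in [u = t ^ nu], with
    [A = Gamma a] and [A2 = Gamma (a + nu)], is nonnegative.  Integrating it
    against [t ^ (a - nu - 1) exp (- t)] gives [A2 (A2 A1 - A ^ 2) >= 0], where
    [A1 = Gamma (a - nu)]. *)
Lemma Euler_integral_log_convex a nu : 0 < a - nu -> 0 < a + nu ->
  Euler_integral a ^ 2 <= Euler_integral (a + nu) * Euler_integral (a - nu).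
Proof.
intros H1 H2.
destruct (Euler_integral_correct a ltac:(lra)) as [P I].
destruct (Euler_integral_correct _ H1) as [P1 I1].
destruct (Euler_integral_correct _ H2) as [P2 I2].
set (A := Euler_integral a) in *. set (A1 := Euler_integral (a - nu)) in *.
set (A2 := Euler_integral (a + nu)) in *.
pose proof (is_RInt_gen_plus _ _ _ _ (is_RInt_gen_plus _ _ _ _ 
  (is_RInt_gen_scal _ (A ^ 2) _ I2) (is_RInt_gen_scal _ (- (2 * A * A2)) _ I))
  (is_RInt_gen_scal _ (A2 ^ 2) _ I1)) as J.
apply is_RInt_gen_nonneg in J.
- unfold plus, scal in J; simpl in J; unfold mult in J; simpl in J. nra.
- intros t Ht. unfold plus, scal; simpl; unfold mult; simpl.
  unfold gamma_integrand.
  replace (a + nu - 1) with (a - 1 - nu + 2 * nu) by ring.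
  replace (a - nu - 1) with (a - 1 - nu) by ring.
  replace (a - 1) with (a - 1 - nu + nu) at 2 by ring.
  replace (2 * nu) with (nu + nu) by ring. rewrite !Rpower_plus.
  set (u := Rpower t nu). 
  pose proof (exp_pos (- t)). assert (0 < Rpower t (a - 1 - nu)) by apply exp_pos.
  set (w := Rpower t (a - 1 - nu)) in *.
  match goal with |- 0 <= ?x => replace x with (w * exp (- t) * (A * u - A2) ^ 2) by ring end.
  apply Rmult_le_pos; [nra|apply pow2_ge_0].
Qed.


(** * Cosine moments of powers of the cosine *)

Definition cos_moment (nu : R) (n : nat) : R :=
  RInt (fun t => cos t ^ (2 * n) * cos (2 * nu * t)) 0 (PI / 2).

Lemma is_RInt_cos_moment nu n :
  is_RInt (fun t => cos t ^ (2 * n) * cos (2 * nu * t)) 0 (PI / 2) (cos_moment nu n).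
Proof.
apply (RInt_correct (fun t => cos t ^ (2 * n) * cos (2 * nu * t))).
apply (ex_RInt_continuous (fun t => cos t ^ (2 * n) * cos (2 * nu * t))).
intros z _. apply (ex_derive_continuous (fun t => cos t ^ (2 * n) * cos (2 * nu * t))).
auto_derive. easy.
Qed.

Lemma cos_moment_0 nu : nu <> 0 -> cos_moment nu 0 = sin (nu * PI) / (2 * nu).
Proof.
intros Hnu. unfold cos_moment.
apply is_RInt_unique.
replace (sin (nu * PI) / (2 * nu))
  with (minus (sin (2 * nu * (PI / 2)) / (2 * nu)) (sin (2 * nu * 0) / (2 * nu))).
- apply (is_RInt_derive (fun t => sin (2 * nu * t) / (2 * nu))).
  + intros x _. auto_derive; [easy|]. simpl. field. easy.
  + intros x _.
    apply (ex_derive_continuous (fun t => cos t ^ 0 * cos (2 * nu * t))).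
    auto_derive. easy.
- unfold minus, plus, opp; simpl. rewrite Rmult_0_r, sin_0.
  replace (2 * nu * (PI / 2)) with (nu * PI) by field. field. easy.
Qed.

Lemma cos_moment_0_0 : cos_moment 0 0 = PI / 2.
Proof.
unfold cos_moment. rewrite (RInt_ext _ (fun _ => 1)).
- rewrite RInt_const. unfold scal; simpl; unfold mult; simpl. ring.
- intros x _. simpl. rewrite Rmult_0_r, Rmult_0_l, cos_0. ring.
Qed.

(** Both sides differ by the integral of the derivative of [f] below.  That
    combination of [cos^(2n+1) t sin t cos (2 nu t)] and
    [cos^(2n+2) t sin (2 nu t)] is chosen so that the terms in
    [sin t sin (2 nu t)] cancel in its derivative; it vanishes at both ends. *)
Lemma cos_moment_S nu n :
  2 * (INR (S n) - nu) * (INR (S n) + nu) * cos_moment nu (S n)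
  = INR (S n) * (2 * INR n + 1) * cos_moment nu n.
Proof.
set (k := INR (S n)).
set (f := fun t => k * (cos t ^ (2 * n + 1) * sin t * cos (2 * nu * t))
                   - nu * (cos t ^ (2 * S n) * sin (2 * nu * t))).
assert (Hk : INR n = k - 1) by (unfold k; rewrite S_INR; ring).
assert (H : is_RInt (fun t =>
     minus (scal (2 * (k - nu) * (k + nu)) (cos t ^ (2 * S n) * cos (2 * nu * t)))
      (scal (k * (2 * INR n + 1)) (cos t ^ (2 * n) * cos (2 * nu * t))))
   0 (PI / 2) (minus (f (PI / 2)) (f 0))).
{ apply (is_RInt_derive f).
  - intros x _. unfold f. auto_derive; [easy|].
    unfold minus, plus, opp, scal; simpl; unfold mult; simpl.
    replace (pred (n + (n + 0) + 1)) with (2 * n)%nat by lia.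
    replace (pred (S (n + S (n + 0)))) with (2 * n + 1)%nat by lia.
    replace (n + S (n + 0))%nat with (2 * n + 1)%nat by lia.
    replace (n + (n + 0))%nat with (2 * n)%nat by lia.
    pose proof (sin2_cos2 x) as P. unfold Rsqr in P.
    replace (n + (n + 0) + 1)%nat with (S (2 * n)) by lia.
    rewrite Hk. rewrite pow_add. set (c2n := cos x ^ (2 * n)).
    replace (2 * n + 1)%nat with (S (2 * n)) by lia. cbv iota.
    rewrite S_INR, mult_INR, Hk. simpl.
    (* Homogenise in sine and cosine, using [sin^2 + cos^2 = 1] once. *)
    match goal with |- ?a = ?b =>
     replace b with (b - c2n * cos (2 * nu * x) * (k * (2 * k - 1)) * (sin x * sin x + cos x * cos x - 1)) by (rewrite P; ring)
    end.
    ring.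
  - intros x _. unfold minus, plus, opp, scal; simpl; unfold mult; simpl.
    apply (ex_derive_continuous (fun t : R =>
      2 * (k - nu) * (k + nu) * (cos t * cos t ^ (n + S (n + 0)) * cos (2 * nu * t)) +
      - (k * (2 * INR n + 1) * (cos t ^ (n + (n + 0)) * cos (2 * nu * t))))).
    auto_derive. easy. }
assert (Z : minus (f (PI / 2)) (f 0) = 0).
{ unfold f, minus, plus, opp; simpl.
  rewrite cos_PI2, Rmult_0_r, sin_0, !pow_ne_zero by lia. ring. }
rewrite Z in H.
pose proof (is_RInt_cos_moment nu) as I.
pose proof (is_RInt_minus _ _ _ _ _ _ (is_RInt_scal _ _ _ (2 * (k - nu) * (k + nu)) _ (I (S n)))
   (is_RInt_scal _ _ _ (k * (2 * INR n + 1)) _ (I n))) as H2.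
apply (is_RInt_unique (V := R_CompleteNormedModule)) in H.
apply (is_RInt_unique (V := R_CompleteNormedModule)) in H2.
assert (E := eq_trans (eq_sym H2) H). clear H. rename E into H.
unfold minus, plus, opp, scal in H; simpl in H; unfold mult in H; simpl in H.
lra.
Qed.

(** Since [0 <= nu t <= t <= PI / 2], [sin (nu t) <= sin t], so that
    [cos (2 nu t) >= 1 - 2 sin^2 t = 2 cos^2 t - 1].  Against [cos^(2n)] the
    right side integrates to [2 I_{n+1}(0) - I_n(0)], which the recurrence
    evaluates. *)
Lemma cos_moment_ge nu n : 0 <= nu <= 1 ->
  INR n / (INR n + 1) * cos_moment 0 n <= cos_moment nu n.
Proof.
intros Hnu.
assert (HS : cos_moment 0 (S n) = (2 * INR n + 1) / (2 * (INR n + 1)) * cos_moment 0 n).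
{ pose proof (cos_moment_S 0 n) as H. rewrite S_INR in H. pose proof (pos_INR n).
  apply (Rmult_eq_reg_l (2 * (INR n + 1) * (INR n + 1))); [|nra].
  transitivity ((INR n + 1) * (2 * INR n + 1) * cos_moment 0 n).
  - rewrite <- H. ring.
  - field. lra. }
assert (E : INR n / (INR n + 1) * cos_moment 0 n
     = minus (scal 2 (cos_moment 0 (S n))) (cos_moment 0 n)).
{ rewrite HS. unfold minus, plus, opp, scal; simpl; unfold mult; simpl.
  pose proof (pos_INR n). field. lra. }
rewrite E.
pose proof is_RInt_cos_moment as I.
pose proof PI2_1.
apply (is_RInt_le _ _ 0 (PI / 2) _ _ ltac:(lra)
   (is_RInt_minus _ _ _ _ _ _ (is_RInt_scal _ _ _ 2 _ (I 0 (S n))) (I 0 n)) (I nu n)).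
intros t Ht. unfold minus, plus, opp, scal; simpl; unfold mult; simpl.
rewrite Rmult_0_r, Rmult_0_l, cos_0.
replace (n + S (n + 0))%nat with (S (2 * n)) by lia.
replace (n + (n + 0))%nat with (2 * n)%nat by lia. simpl pow.
assert (P : 0 <= cos t ^ (2 * n)) by (apply pow_le, cos_ge_0; lra).
assert (Q : sin (nu * t) ^ 2 <= sin t ^ 2).
{ apply pow_incr. split.
  - apply sin_ge_0; nra.
  - apply sin_incr_1; nra. }
replace (2 * nu * t) with (2 * (nu * t)) by ring. rewrite cos_2a_sin.
pose proof (sin2_cos2 t) as T. unfold Rsqr in T.
change (cos t ^ (n + (n + 0))) with (cos t ^ (2 * n)).
set (c := cos t ^ (2 * n)) in *.
nra.
Qed.

Lemma cos_moment_0_pos n : 0 < cos_moment 0 n.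
Proof.
induction n as [|n IH].
- rewrite cos_moment_0_0. pose proof PI2_1. lra.
- pose proof (cos_moment_S 0 n) as H. pose proof (pos_INR n). rewrite S_INR in H.
  assert (0 < (INR n + 1) * (2 * INR n + 1) * cos_moment 0 n).
  { repeat apply Rmult_lt_0_compat; lra. }
  nra.
Qed.

(** * One half of the reflection formula *)

(** The two Gamma factors absorb the factors [n + 1 - nu] and [n + 1 + nu] of
    the recurrence for the cosine moments, whose remaining coefficient is then
    the same for all [nu]. *)
Definition gamma_cos_moment (nu : R) (n : nat) : R :=
  Euler_integral (INR n + 1 + nu) * Euler_integral (INR n + 1 - nu) * cos_moment nu n.

Lemma gamma_cos_moment_S nu n : -1 < nu < 1 ->
  gamma_cos_moment nu (S n)
  = (INR n + 1) * (2 * INR n + 1) / 2 * gamma_cos_moment nu n.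
Proof.
intros Hnu. unfold gamma_cos_moment. pose proof (pos_INR n).
pose proof (cos_moment_S nu n) as HS. rewrite S_INR in *.
replace (INR n + 1 + 1 + nu) with (INR n + 1 + nu + 1) by ring.
replace (INR n + 1 + 1 - nu) with (INR n + 1 - nu + 1) by ring.
rewrite !Euler_integral_S by lra.
set (A := Euler_integral _). set (B := Euler_integral _).
transitivity (A * B * (2 * (INR n + 1 - nu) * (INR n + 1 + nu) * cos_moment nu (S n)) / 2);
  [field|rewrite HS; field].
Qed.

(** The ratio of the values at [nu] and at 0 is independent of [n]. *)
Lemma gamma_cos_moment_cross nu n : -1 < nu < 1 ->
  gamma_cos_moment nu n * gamma_cos_moment 0 0 = gamma_cos_moment 0 n * gamma_cos_moment nu 0.
Proof.
intros Hnu. induction n as [|n IH]; [ring|].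
rewrite !gamma_cos_moment_S by lra.
set (c := (INR n + 1) * (2 * INR n + 1) / 2).
rewrite Rmult_assoc, IH. ring.
Qed.

Lemma gamma_cos_moment_pos_0 n : 0 < gamma_cos_moment 0 n.
Proof.
unfold gamma_cos_moment. pose proof (pos_INR n).
repeat apply Rmult_lt_0_compat; try (apply Euler_integral_correct; lra).
apply cos_moment_0_pos.
Qed.

Lemma gamma_cos_moment_ge nu n : 0 <= nu < 1 ->
  INR n / (INR n + 1) * gamma_cos_moment 0 n <= gamma_cos_moment nu n.
Proof.
intros Hnu. unfold gamma_cos_moment. pose proof (pos_INR n).
rewrite Rplus_0_r, Rminus_0_r.
pose proof (Euler_integral_log_convex (INR n + 1) nu ltac:(lra) ltac:(lra)) as HE.
pose proof (cos_moment_ge nu n ltac:(lra)) as HI.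
pose proof (cos_moment_0_pos n) as H0.
set (A := Euler_integral (INR n + 1)) in *.
assert (Q : 0 <= INR n / (INR n + 1)).
{ apply Rmult_le_pos; [lra|]. apply Rlt_le, Rinv_0_lt_compat; lra. }
replace (INR n / (INR n + 1) * (A * A * cos_moment 0 n))
  with (A ^ 2 * (INR n / (INR n + 1) * cos_moment 0 n)) by ring.
apply Rmult_le_compat; try easy.
- apply pow2_ge_0.
- apply Rmult_le_pos; lra.
Qed.

(** The ratio of the two sides equals its value at every [n], where it is at
    least [n / (n + 1)]. *)
Lemma gamma_cos_moment_0_le nu : 0 <= nu < 1 ->
  gamma_cos_moment 0 0 <= gamma_cos_moment nu 0.
Proof.
intros Hnu. set (a := gamma_cos_moment 0 0). set (b := gamma_cos_moment nu 0).
assert (Ha : 0 < a) by apply gamma_cos_moment_pos_0.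
assert (H : forall n, INR n / (INR n + 1) * a <= b).
{ intros n. pose proof (gamma_cos_moment_pos_0 n) as Hn.
  apply (Rmult_le_reg_l (gamma_cos_moment 0 n)); [easy|].
  unfold b. rewrite <- gamma_cos_moment_cross by lra. fold a.
  pose proof (gamma_cos_moment_ge nu n Hnu) as G.
  apply (Rmult_le_compat_r a) in G; lra. }
destruct (Rle_lt_dec a b) as [|Hlt]; [easy|exfalso].
destruct (archimed_cor1 ((a - b) / a)) as (N & HN & Npos).
{ apply Rdiv_lt_0_compat; lra. }
destruct N as [|n]; [lia|]. specialize (H n). rewrite S_INR in HN.
pose proof (pos_INR n).
apply (Rmult_lt_compat_r a) in HN; [|easy].
replace ((a - b) / a * a) with (a - b) in HN by (field; lra).
replace (INR n / (INR n + 1) * a) with (a - / (INR n + 1) * a) in H by (field; lra).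
lra.
Qed.

Lemma Euler_integral_reflection nu : 0 < nu < 1 ->
  / (Euler_integral (nu + 1) * Euler_integral (- nu + 1)) <= sin (nu * PI) / (nu * PI).
Proof.
intros Hnu. pose proof (gamma_cos_moment_0_le nu ltac:(lra)) as H.
unfold gamma_cos_moment in H.
rewrite cos_moment_0_0, cos_moment_0 in H by lra.
simpl INR in H. rewrite Rplus_0_l, Rplus_0_r, Rminus_0_r, Euler_integral_1 in H.
replace (1 + nu) with (nu + 1) in H by ring. replace (1 - nu) with (- nu + 1) in H by ring.
set (B := Euler_integral (nu + 1) * Euler_integral (- nu + 1)) in *.
assert (HB : 0 < B) by (apply Rmult_lt_0_compat; apply Euler_integral_correct; lra).
pose proof PI_RGT_0.
apply (Rmult_le_reg_l (B * (PI / 2))); [apply Rmult_lt_0_compat; lra|].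
replace (B * (PI / 2) * / B) with (1 * 1 * (PI / 2)) by (field; lra).
replace (B * (PI / 2) * (sin (nu * PI) / (nu * PI)))
  with (B * (sin (nu * PI) / (2 * nu))) by (field; lra).
easy.
Qed.

(** * Bessel functions of order greater than -1 *)

Lemma Euler_integral_rising mu k : -1 < mu ->
  Euler_integral (INR k + mu + 1) = rising (mu + 1) k * Euler_integral (mu + 1).
Proof.
intros Hmu. induction k as [|k IH].
- simpl. rewrite Rplus_0_l. ring.
- rewrite S_INR. pose proof (pos_INR k).
  replace (INR k + 1 + mu + 1) with (INR k + mu + 1 + 1) by ring.
  rewrite Euler_integral_S, IH by lra. simpl. ring.
Qed.

Lemma inv_Gamma_pos y : 0 < y -> inv_Gamma y = / Euler_integral y.
Proof.
intros Hy. unfold inv_Gamma.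
destruct (ClassicalEpsilon.excluded_middle_informative _) as [[n Hn]|_].
- pose proof (pos_INR n). lra.
- unfold Gamma.
  assert (S0 : Gamma_shift y = 0%nat).
  { unfold Gamma_shift. destruct (archimed (- y)) as [_ U].
    assert (up (- y) < 1)%Z by (apply lt_IZR; lra). lia. }
  rewrite S0. simpl. now rewrite Rplus_0_r, Rdiv_1_r.
Qed.

Lemma BesselJ_PSeries mu x : -1 < mu -> 0 < x ->
  BesselJ mu x
  = Rpower (x / 2) mu / Euler_integral (mu + 1) * PSeries (bessel_coef mu) ((x / 2) ^ 2).
Proof.
intros Hmu Hx. unfold BesselJ, PSeries. rewrite <- Series_scal_l.
apply Series_ext. intros k. pose proof (pos_INR k).
rewrite inv_Gamma_pos, Euler_integral_rising by lra.
rewrite Rpower_plus. replace (2 * INR k) with (INR (2 * k)) by (rewrite mult_INR; simpl; ring).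
rewrite Rpower_pow, pow_mult by lra.
unfold bessel_coef.
pose proof (rising_pos (mu + 1) k ltac:(lra)).
destruct (Euler_integral_correct (mu + 1) ltac:(lra)) as [E _].
pose proof (INR_fact_neq_0 k).
field. repeat split; try easy; lra.
Qed.

Theorem lemma1p6 :
  forall nu : R, 0 < nu < 1 ->
  forall x : R, 0 < x ->
  BesselJ nu x * BesselJ (- nu) x < sin (nu * PI) / (nu * PI).
Proof.
intros nu Hnu x Hx.
apply Rlt_le_trans with (2 := Euler_integral_reflection nu Hnu).
rewrite !BesselJ_PSeries by lra.
assert (Hs : 0 < (x / 2) ^ 2) by (apply pow_lt; lra).
pose proof (bessel_product_lt_1 nu _ Hnu Hs) as HP.
assert (HR : Rpower (x / 2) nu * Rpower (x / 2) (- nu) = 1).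
{ rewrite <- Rpower_plus, Rplus_opp_r. apply Rpower_O; lra. }
destruct (Euler_integral_correct (nu + 1) ltac:(lra)) as [E1 _].
destruct (Euler_integral_correct (- nu + 1) ltac:(lra)) as [E2 _].
set (A := Euler_integral (nu + 1)) in *. set (B := Euler_integral (- nu + 1)) in *.
set (f := PSeries (bessel_coef nu) _) in *.
set (g := PSeries (bessel_coef (- nu)) _) in *.
replace (Rpower (x / 2) nu / A * f * (Rpower (x / 2) (- nu) / B * g))
  with (Rpower (x / 2) nu * Rpower (x / 2) (- nu) * (/ (A * B) * (f * g))) by (field; lra).
rewrite HR, Rmult_1_l. rewrite <- (Rmult_1_r (/ (A * B))) at 2.
apply Rmult_lt_compat_l; [|easy].
apply Rinv_0_lt_compat, Rmult_lt_0_compat; easy.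
Qed.
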